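(* Let $G$ be any infinite countable group with identity $\mathbf{i}$, and let $\mu$ be any $G$-invariant ergodic probability measure on $\{0,1\}^G$ with $p=\mu(\Gamma(\mathbf{i})=1)\in(0,1)$, where $\Gamma$ has law $\mu$. Then there exists an extra head scheme for $\mu$.
   Context: $\{0,1\}^G$ carries the product $\sigma$-algebra. A group element $g$ acts on $\gamma\in\{0,1\}^G$ by $(g\gamma)(x)=\gamma(g^{-1}x)$; invariance and ergodicity of $\mu$ are with respect to this action. $\mu^*(\cdot)=\mu(\Gamma\in\cdot\mid\Gamma(\mathbf{i})=1)$. A $G$-valued random variable $X$ on some joint probability space with $\Gamma$ is an extra head scheme for $\mu$ if $X^{-1}\Gamma$ has law $\mu^*$. *)

(* Defs.v *)
From HB Require Import structures.
From mathcomp Require Import all_boot all_order all_algebra.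
From mathcomp Require Import all_classical all_reals all_analysis.

Set Implicit Arguments.
Unset Strict Implicit.
Unset Printing Implicit Defensive.

Local Open Scope classical_set_scope.
Local Open Scope ereal_scope.

(* The generators are the preimages of measurable sets of bool under the
   coordinate maps, as for the library's finite product sigma-algebras. *)
Definition cylinders (G : Type) : set (set (G -> bool)) :=
  \bigcup_(x in [set: G])
    preimage_set_system setT (fun gamma : G -> bool => gamma x) measurable.
Arguments cylinders G : clear implicits.

Definition config (G : Type) : measurableType (sigma_display (cylinders G)) :=
  g_sigma_algebraType (cylinders G).

(* MathComp does not attach a sigma-algebra to a group, so G-valued random
   variables take their values in this alias of G, where every set is
   measurable. *)
Definition discrete_group (G : groupType) : Type := G.

HB.instance Definition _ (G : groupType) := Choice.on (discrete_group G).
HB.instance Definition _ (G : groupType) :=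
  isPointed.Build (discrete_group G) (1%g : G).
HB.instance Definition _ (G : groupType) :=
  @isMeasurable.Build default_measure_display (discrete_group G)
    discrete_measurable discrete_measurable0
    discrete_measurableC discrete_measurableU.

Section ExtraHead.
Context {R : realType} {G : groupType}.

Definition translate (g : G) (gamma : config G) : config G :=
  fun x => gamma (g^-1 * x)%g.

Definition invariant_measure (mu : probability (config G) R) : Prop :=
  forall (g : G) (A : set (config G)), measurable A ->
    mu (translate g @^-1` A) = mu A.

(* Invariance of A is stated with preimages; since g ranges over a group this
   is the same as the image of A under every g being A. *)
Definition ergodic_measure (mu : probability (config G) R) : Prop :=
  forall A : set (config G), measurable A ->
    (forall g : G, translate g @^-1` A = A) -> mu A = 0 \/ mu A = 1.

Definition head_at_id : set (config G) := [set gamma | gamma 1%g = true].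

Definition conditional_law (mu : probability (config G) R) :
    set (config G) -> \bar R :=
  fun A => mu (A `&` head_at_id) / mu head_at_id.

Definition has_law d d' (Omega : measurableType d) (T : measurableType d')
    (P : probability Omega R) (f : Omega -> T) (nu : set T -> \bar R) : Prop :=
  measurable_fun setT f /\
  forall A : set T, measurable A -> pushforward P f A = nu A.

Definition extra_head_scheme d (Omega : measurableType d)
    (P : probability Omega R) (mu : probability (config G) R)
    (Gamma : {RV P >-> config G}) (X : {RV P >-> discrete_group G}) : Prop :=
  has_law P Gamma mu /\
  has_law P (fun omega => translate (X omega : G)^-1%g (Gamma omega))
    (conditional_law mu).

End ExtraHead.

(* Main.v *)
Require Import Defs.
From mathcomp Require Import all_boot all_order all_algebra.
From mathcomp Require Import all_classical all_reals all_analysis.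
From mathcomp Require Import measurable_realfun ring.
From HB Require Import structures.
Import Order.TTheory GRing.Theory Num.Theory.

Set Implicit Arguments.
Unset Strict Implicit.
Unset Printing Implicit Defensive.

Local Open Scope ring_scope.
Local Open Scope classical_set_scope.
Local Open Scope ereal_scope.

(** Write [p] for the probability of a head at the identity.  By invariance of
    [mu], an extra head scheme amounts to a transport of mass along the orbits
    of [G] on the configurations: every configuration [gamma] supplies mass [1]
    (with respect to [mu]), demands mass [b0 gamma := 1 / p] if it has a head
    at the identity and [0] otherwise, and mass may be shipped from [gamma] to
    [g^-1 gamma] for any [g].  If [m_g gamma] is the mass so shipped, with
    [sum_g m_g gamma = 1] and [sum_g m_g (g gamma) = b0 gamma] for almost every
    [gamma], then choosing [X = g] with conditional probability [m_g Gamma]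
    gives [X^-1 Gamma] the density [b0], which is that of the conditional law.

    Such a transport is found greedily.  Enumerate [G] as [e 0, e 1, ...], and
    at step [k] ship from [x] to [(e k)^-1 x] the minimum of the supply left at
    [x] and the demand left at [(e k)^-1 x].  After step [k] one of the two is
    exhausted; so (lemma [exhausted]), for all [x] and [g], either [x] ends up
    with all its supply shipped, or [g^-1 x] with all its demand met.  The set
    [unmet] of the configurations having some translate with unmet demand is
    invariant, and on it all the supply is shipped, while off it all the demand
    is met.  By ergodicity [unmet] is null or conull; in the first case almost
    all the demand is met, in the second almost all the supply is shipped.  As
    the total mass shipped equals the total mass received by invariance, and
    the total supply and the total demand are both [1], both hold in each case
    (lemma [balanced_transport]).  The scheme lives on the product of the
    configurations with the discrete group; its probability is built by
    [mixture_probability]. *)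

(** * Greedy transport *)

Section Greedy.
Context {R : realType} {T : Type}.
Variables (s t : nat -> T -> T) (a0 b0 : T -> R).

(** The supply left at each source and the demand left at each target before
    step [k], starting from [a0] and [b0].  Step [k] ships from [x] to [s k x];
    [t k] is meant to be the inverse of [s k], so that [t k y] is the source
    shipping to [y]. *)
Fixpoint residual (k : nat) : (T -> R) * (T -> R) :=
  if k is j.+1 then
    let a := (residual j).1 in let b := (residual j).2 in
    ((fun x => a x - Num.min (a x) (b (s j x)))%R,
     (fun y => b y - Num.min (a (t j y)) (b y))%R)
  else (a0, b0).

(** The supply left at a point before step [k]. *)
Definition supply k := (residual k).1.

(** The demand left at a point before step [k]. *)
Definition demand k := (residual k).2.

(** The mass shipped at step [k] from [x] to [s k x]. *)
Definition shipment k x := Num.min (supply k x) (demand k (s k x)).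

(** The total mass shipped from [x], over all the steps. *)
Definition shipped x : \bar R := \sum_(k <oo) (shipment k x)%:E.

(** The total mass received by [y], over all the steps. *)
Definition received y : \bar R := \sum_(k <oo) (shipment k (t k y))%:E.

Hypothesis stK : forall k, cancel (t k) (s k).
Hypothesis tsK : forall k, cancel (s k) (t k).
Hypothesis a0_ge0 : forall x, (0 <= a0 x)%R.
Hypothesis b0_ge0 : forall x, (0 <= b0 x)%R.

Lemma supplyS k x : supply k.+1 x = (supply k x - shipment k x)%R.
Proof. by []. Qed.

Lemma demandS k y : demand k.+1 y = (demand k y - shipment k (t k y))%R.
Proof. by rewrite /shipment stK. Qed.

Lemma residual_ge0 k : (forall x, 0 <= supply k x)%R /\ (forall y, 0 <= demand k y)%R.
Proof.
elim: k => [|k [IHa IHb]]; first by [].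
split=> x; first by rewrite supplyS subr_ge0 /shipment ge_min lexx.
by rewrite demandS subr_ge0 /shipment stK ge_min lexx orbT.
Qed.

Lemma shipment_ge0 k x : (0 <= shipment k x)%R.
Proof. by have [ha hb] := residual_ge0 k; rewrite le_min ha hb. Qed.

Lemma sum_shipment n x : (\sum_(0 <= k < n) shipment k x = a0 x - supply n x)%R.
Proof.
elim: n => [|n IH]; first by rewrite big_geq// subrr.
by rewrite big_nat_recr//= IH supplyS; ring.
Qed.

Lemma sum_receipt n y :
  (\sum_(0 <= k < n) shipment k (t k y) = b0 y - demand n y)%R.
Proof.
elim: n => [|n IH]; first by rewrite big_geq// subrr.
by rewrite big_nat_recr//= IH demandS; ring.
Qed.

Lemma shipped_ge0 x : 0 <= shipped x.
Proof. by apply: nneseries_ge0 => k _ _; rewrite lee_fin shipment_ge0. Qed.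

Lemma received_ge0 y : 0 <= received y.
Proof. by apply: nneseries_ge0 => k _ _; rewrite lee_fin shipment_ge0. Qed.

Lemma shipped_le x : shipped x <= (a0 x)%:E.
Proof.
apply: lime_le.
  by apply: is_cvg_nneseries => k _ _; rewrite lee_fin shipment_ge0.
apply: nearW => n; rewrite sumEFin lee_fin sum_shipment lerBlDr lerDl.
exact: (residual_ge0 n).1.
Qed.

Lemma received_le y : received y <= (b0 y)%:E.
Proof.
apply: lime_le.
  by apply: is_cvg_nneseries => k _ _; rewrite lee_fin shipment_ge0.
apply: nearW => n; rewrite sumEFin lee_fin sum_receipt lerBlDr lerDl.
exact: (residual_ge0 n).2.
Qed.

(** Step [k] uses up the smaller of the supply left at [x] and the demand left
    at [s k x]. *)
Lemma exhausted k x :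
  shipped x = (a0 x)%:E \/ received (s k x) = (b0 (s k x))%:E.
Proof.
have [le_ab|le_ba] := leP (supply k x) (demand k (s k x)).
- left; apply/eqP; rewrite eq_le shipped_le /=.
  have -> : a0 x = (\sum_(0 <= j < k.+1) shipment j x)%R.
    by rewrite sum_shipment supplyS /shipment min_l// subrr subr0.
  rewrite -sumEFin; apply: nneseries_lim_ge => j _ _.
  by rewrite lee_fin shipment_ge0.
- right; apply/eqP; rewrite eq_le received_le /=.
  have -> : b0 (s k x) = (\sum_(0 <= j < k.+1) shipment j (t j (s k x)))%R.
    rewrite sum_receipt demandS tsK /shipment min_r ?subrr ?subr0//.
    exact: ltW.
  rewrite -sumEFin; apply: nneseries_lim_ge => j _ _.
  by rewrite lee_fin shipment_ge0.
Qed.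

End Greedy.

(** * Measurability of the greedy transport *)

Section Measurability.
Context {R : realType} {d : measure_display} {T : measurableType d}.
Variables (s t : nat -> T -> T) (a0 b0 : T -> R).
Hypothesis stK : forall k, cancel (t k) (s k).
Hypothesis a0_ge0 : forall x, (0 <= a0 x)%R.
Hypothesis b0_ge0 : forall x, (0 <= b0 x)%R.
Hypothesis ms : forall k, measurable_fun setT (s k).
Hypothesis mt : forall k, measurable_fun setT (t k).
Hypothesis ma0 : measurable_fun setT a0.
Hypothesis mb0 : measurable_fun setT b0.

Lemma measurable_residual k :
  measurable_fun setT (supply s t a0 b0 k) /\
  measurable_fun setT (demand s t a0 b0 k).
Proof.
elim: k => [|k [IHa IHb]]; first by [].
split; apply: measurable_funB => //; apply: measurable_minr => //.
- by apply: measurableT_comp.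
- by apply: measurableT_comp.
Qed.

Lemma measurable_shipment k : measurable_fun setT (shipment s t a0 b0 k).
Proof.
have [ha hb] := measurable_residual k.
by apply: measurable_minr => //; apply: measurableT_comp.
Qed.

Lemma measurable_shipped : measurable_fun setT (shipped s t a0 b0).
Proof.
apply: ge0_emeasurable_sum => [k x _ _|k _].
  by rewrite lee_fin shipment_ge0.
by apply/measurable_EFinP; exact: measurable_shipment.
Qed.

Lemma measurable_received : measurable_fun setT (received s t a0 b0).
Proof.
pose h k x := (shipment s t a0 b0 k (t k x))%:E.
apply: (ge0_emeasurable_sum _ (h := h)) => [k x _ _|k _].
  by rewrite lee_fin shipment_ge0.
apply/measurable_EFinP; apply: measurableT_comp => //.
exact: measurable_shipment.
Qed.

End Measurability.

(** * Translations of configurations *)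

Lemma measurable_to_config (G : groupType) d (T : measurableType d) (f : T -> config G) :
  (forall x : G, measurable_fun setT (fun w => f w x)) -> measurable_fun setT f.
Proof.
move=> mf; apply: (@measurability _ _ _ (config G) _ f (cylinders G)) => //.
move=> _ [_ [x _ [B mB <-]] <-]; rewrite !setTI.
by rewrite -[X in measurable X]setTI; exact: (mf x).
Qed.

Lemma measurable_coordinate (G : groupType) (x : G) :
  measurable_fun setT (fun gamma : config G => gamma x).
Proof.
move=> _ B mB; apply: sub_sigma_algebra; exists x => //.
by exists B.
Qed.

Lemma measurable_translate (G : groupType) (g : G) : measurable_fun setT (translate g).
Proof. by apply: measurable_to_config => x; exact: measurable_coordinate. Qed.

Lemma translateM (G : groupType) (g h : G) (gamma : config G) :
  translate g (translate h gamma) = translate (g * h)%g gamma.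
Proof. by apply/funext => x; rewrite /translate invgM mulgA. Qed.

Lemma translate1 (G : groupType) (gamma : config G) : translate 1%g gamma = gamma.
Proof. by apply/funext => x; rewrite /translate invg1 mul1g. Qed.

Lemma translateK (G : groupType) (g : G) : cancel (translate g) (translate g^-1%g).
Proof. by move=> gamma; rewrite translateM mulVg translate1. Qed.

Lemma translateVK (G : groupType) (g : G) : cancel (translate g^-1%g) (translate g).
Proof. by move=> gamma; rewrite translateM mulgV translate1. Qed.

Lemma countable_enum (G : groupType) : countable [set: G] ->
  exists e : nat -> G, forall g, exists k, e k = g.
Proof.
move=> cG; have /(@pcard_surjP (discrete_group G))[e eS] := cG.
by exists e => g; have [k _ <-] := eS g I; exists k.
Qed.

(** The map [(gamma, g) |-> g^-1 gamma] is jointly measurable: [G] being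
    countable, the preimage of an event about one coordinate is a countable
    union of rectangles. *)
Lemma measurable_recentre (G : groupType) : countable [set: G] ->
  measurable_fun setT (fun w : config G * discrete_group G =>
    translate (w.2 : G)^-1%g w.1).
Proof.
move=> /countable_enum[e e_surj]; apply: measurable_to_config => x _ B mB.
rewrite setTI [X in measurable X](_ : _ = \bigcup_k
    (((fun gamma : config G => gamma ((e k)^-1^-1 * x)%g) @^-1` B) `*`
     [set (e k : discrete_group G)])).
  apply: bigcupT_measurable => k; apply: measurableX => //.
  by rewrite -[X in measurable X]setTI; apply: measurable_coordinate.
apply/seteqP; split=> [[gamma g] /=|[gamma g] [k _ [/= ? ->//]]].
by have [k <-] := e_surj g; exists k.
Qed.

Lemma measurable_head (G : groupType) : measurable (@head_at_id G).
Proof.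
rewrite -[head_at_id]setTI.
have mB : measurable [set true] by [].
exact: (measurable_coordinate 1%g measurableT mB).
Qed.

(** * Integration *)

(** The law of [phi k x], for a random pair [(k, x)] whose density with respect
    to the product of the counting measure and [mu] is [f k x]. *)
Lemma mixture_probability (R : realType) d (T : measurableType d)
    (mu : {measure set T -> \bar R}) d' (Y : measurableType d')
    (phi : nat -> T -> Y) (f : nat -> T -> \bar R) :
  (forall k, measurable_fun setT (phi k)) ->
  (forall k, measurable_fun setT (f k)) -> (forall k x, 0 <= f k x) ->
  \sum_(k <oo) \int[mu]_x f k x = 1 ->
  exists P : probability Y R, forall A,
    P A = \sum_(k <oo) \int[mu]_(x in phi k @^-1` A) f k x.
Proof.
move=> mphi mf f0 f1.
pose Q (A : set Y) := \sum_(k <oo) \int[mu]_(x in phi k @^-1` A) f k x.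
have Q0 : Q set0 = 0.
  by rewrite /Q eseries0// => k _ _; rewrite preimage_set0 integral_set0.
have Qge0 A : 0 <= Q A.
  by apply: nneseries_ge0 => k _ _; apply: integral_ge0.
have Qadd : semi_sigma_additive Q.
  move=> F mF tF mUF.
  have -> : Q (\bigcup_n F n) = \sum_(i <oo) Q (F i).
    rewrite /Q nneseries_interchange; last by move=> i j; exact: integral_ge0.
    apply: eq_eseriesr => k _; rewrite preimage_bigcup ge0_integral_bigcup//.
    - by move=> i; rewrite -[X in measurable X]setTI; exact: mphi.
    - exact: measurable_funTS.
    - apply/trivIsetP => i j _ _ ij; rewrite -preimage_setI.
      by move/trivIsetP : tF => /(_ _ _ I I ij) ->; rewrite preimage_set0.
  exact: is_cvg_nneseries.
pose mQ := isMeasure.Build _ _ _ Q Q0 Qge0 Qadd.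
pose Qm : {measure set Y -> \bar R} := HB.pack Q mQ.
have Q1 : Qm setT = 1 by [].
pose pQ := Measure_isProbability.Build _ _ _ Qm Q1.
pose Qp : probability Y R := HB.pack (Qm : set Y -> \bar R) mQ pQ.
by exists Qp.
Qed.

(** If [0 <= f <= h] and both functions have total integral [1], then they have
    the same integral over every event. *)
Lemma eq_integral_of_total (R : realType) d (T : measurableType d)
    (mu : {measure set T -> \bar R}) (f h : T -> \bar R) (A : set T) :
  measurable_fun setT f -> measurable_fun setT h ->
  (forall x, 0 <= f x) -> (forall x, f x <= h x) ->
  \int[mu]_x f x = 1 -> \int[mu]_x h x = 1 -> measurable A ->
  \int[mu]_(x in A) f x = \int[mu]_(x in A) h x.
Proof.
move=> mf mh f0 fh f1 h1 mA.
have h0 x : 0 <= h x by apply: le_trans (fh x).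
have split_int (u : T -> \bar R) : measurable_fun setT u -> (forall x, 0 <= u x) ->
    \int[mu]_x u x = \int[mu]_(x in A) u x + \int[mu]_(x in ~` A) u x.
  move=> mu_ u0; rewrite -(setUv A) ge0_integral_setU//.
  - exact: measurableC.
  - by rewrite setUv.
  - by apply/disj_setPCl.
have leI B : measurable B -> \int[mu]_(x in B) f x <= \int[mu]_(x in B) h x.
  by move=> mB; apply: ge0_le_integral => //; exact: measurable_funTS.
apply/eqP; rewrite eq_le leI//= leNgt; apply/negP => ltA.
have := leI _ (measurableC mA).
move: f1 h1; rewrite (split_int f)// (split_int h)//.
have := integral_ge0 mu (D := A) (fun x _ => f0 x).
have := integral_ge0 mu (D := ~` A) (fun x _ => f0 x).
have := integral_ge0 mu (D := ~` A) (fun x _ => h0 x).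
move: ltA.
move: (\int[mu]_(x in A) f x) (\int[mu]_(x in A) h x) => [u| |] [v| |] //=.
all: move: (\int[mu]_(x in ~` A) f x) (\int[mu]_(x in ~` A) h x) => [u'| |] [v'| |] //=.
rewrite lte_fin => uv _ _ _ [e1] [e2]; rewrite lee_fin => le_uv.
by have := ltr_leD uv le_uv; rewrite e1 e2 ltxx.
Qed.

Lemma integral_translate (R : realType) (G : groupType)
    (mu : probability (config G) R) (g : G) (A : set (config G))
    (f : config G -> \bar R) :
  invariant_measure mu -> measurable A -> measurable_fun setT f ->
  (forall x, 0 <= f x) ->
  \int[mu]_(x in translate g @^-1` A) f (translate g x) = \int[mu]_(x in A) f x.
Proof.
move=> mu_inv mA mf f0.
rewrite -(ge0_integral_pushforward (measurable_translate g) mu mA).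
- apply: eq_measure_integral => [|mt B mB _]; last exact: mu_inv.
  exact: measurable_translate.
- exact: measurable_funTS.
- by move=> x _; exact: f0.
Qed.

(** * Balanced transport and the extra head scheme *)

(** For an ergodic measure, the greedy transport between two probability
    densities [a0] and [b0] ships all the supply and meets all the demand, up to null sets.  Here
    [m k x] is the mass moved from [x] to [(e k)^-1 x]. *)
Lemma balanced_transport (R : realType) (G : groupType)
    (mu : probability (config G) R) (e : nat -> G) (a0 b0 : config G -> R) :
  invariant_measure mu -> ergodic_measure mu ->
  (forall g, exists k, e k = g) ->
  (forall x, (0 <= a0 x)%R) -> (forall x, (0 <= b0 x)%R) ->
  measurable_fun setT a0 -> measurable_fun setT b0 ->
  \int[mu]_x (a0 x)%:E = 1 -> \int[mu]_x (b0 x)%:E = 1 ->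
  exists m : nat -> config G -> \bar R,
    [/\ forall k, measurable_fun setT (m k), forall k x, 0 <= m k x,
      forall A, measurable A ->
        \sum_(k <oo) \int[mu]_(x in A) m k x = \int[mu]_(x in A) (a0 x)%:E &
      forall A, measurable A ->
        \sum_(k <oo) \int[mu]_(x in translate (e k)^-1%g @^-1` A) m k x =
        \int[mu]_(x in A) (b0 x)%:E].
Proof.
move=> mu_inv mu_erg e_surj a0_ge0 b0_ge0 ma0 mb0 a1 b1.
pose t k : config G -> config G := translate (e k).
pose s k : config G -> config G := translate (e k)^-1%g.
have stK k : cancel (t k) (s k) := @translateK G (e k).
have tsK k : cancel (s k) (t k) := @translateVK G (e k).
have ms k : measurable_fun setT (s k) by exact: measurable_translate.
have mt k : measurable_fun setT (t k) by exact: measurable_translate.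
pose m k x := (shipment s t a0 b0 k x)%:E.
have m0 k x : 0 <= m k x by rewrite lee_fin shipment_ge0.
have mm k : measurable_fun setT (m k).
  by apply/measurable_EFinP; exact: measurable_shipment.
have mmt k : measurable_fun setT (fun x => m k (t k x)).
  by apply: measurableT_comp.
pose Sa := shipped s t a0 b0; pose Sb := received s t a0 b0.
have mSa : measurable_fun setT Sa by exact: measurable_shipped.
have mSb : measurable_fun setT Sb by exact: measurable_received.
have Sa0 x : 0 <= Sa x by exact: shipped_ge0.
have Sb0 x : 0 <= Sb x by exact: received_ge0.
have Saa x : Sa x <= (a0 x)%:E by exact: shipped_le.
have Sbb x : Sb x <= (b0 x)%:E by exact: received_le.
have mEa : measurable_fun setT (EFin \o a0) by apply/measurable_EFinP.
have mEb : measurable_fun setT (EFin \o b0) by apply/measurable_EFinP.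
have int_Sa A : measurable A ->
    \sum_(k <oo) \int[mu]_(x in A) m k x = \int[mu]_(x in A) Sa x.
  by move=> mA; rewrite -integral_nneseries// => k; exact: measurable_funTS.
have int_Sb A : measurable A ->
    \sum_(k <oo) \int[mu]_(x in s k @^-1` A) m k x = \int[mu]_(x in A) Sb x.
  move=> mA; transitivity (\int[mu]_(x in A) \sum_(k <oo) m k (t k x)) => //.
  rewrite integral_nneseries//; last first.
    by move=> k; exact: measurable_funTS.
  apply: eq_eseriesr => k _.
  rewrite -(integral_translate (e k) mu_inv)//; last first.
    by rewrite -[X in measurable X]setTI; exact: ms.
  congr (integral _ _ _).
  by apply/seteqP; split=> x /=; rewrite -/(t k x) stK.
(* Invariance of [mu] makes the total mass shipped equal to that received. *)
have eq_tot : \int[mu]_x Sa x = \int[mu]_x Sb x.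
  by rewrite -int_Sa// -int_Sb.
pose unmet := [set x | exists g, Sb (translate g x) < (b0 (translate g x))%:E].
have unmetE : unmet = \bigcup_k [set x | Sb (s k x) < (b0 (s k x))%:E].
  apply/seteqP; split=> x [k]; last by move=> _ /=; exists (e k)^-1%g.
  have [j ej] := e_surj k^-1%g.
  by move=> lt_k; exists j => //=; rewrite /s ej invgK.
have munmet : measurable unmet.
  rewrite unmetE; apply: bigcupT_measurable => k.
  rewrite -[X in measurable X]setTI; apply: measurable_lte => //.
    by apply: measurableT_comp.
  by apply: (measurableT_comp mEb).
have inv_unmet g : translate g @^-1` unmet = unmet.
  apply/seteqP; split=> x [h /=].
    by rewrite translateM => ?; exists (h * g)%g.
  by move=> ?; exists (h * g^-1)%g; rewrite translateM -mulgA mulVg mulg1.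
have sup x : unmet x -> Sa x = (a0 x)%:E.
  rewrite unmetE => -[k _ /= lt_k].
  have [//|/= eq_k] := exhausted stK tsK a0_ge0 b0_ge0 k x.
  by move: lt_k; rewrite /Sb eq_k ltxx.
have dem x : (~` unmet) x -> Sb x = (b0 x)%:E.
  move=> met; apply/eqP; rewrite eq_le Sbb leNgt; apply/negP => lt_x.
  by apply: met; exists 1%g; rewrite translate1.
have one : \int[mu]_x Sa x = 1 /\ \int[mu]_x Sb x = 1.
  have [mu0|mu1] := mu_erg _ munmet inv_unmet.
  - suff Sb1 : \int[mu]_x Sb x = 1 by rewrite eq_tot.
    rewrite -b1 !(ge0_negligible_integral munmet measurableT)//.
    + by apply: eq_integral => x /[!inE] -[_ /dem].
    + by move=> x _; rewrite lee_fin.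
  - suff Sa1 : \int[mu]_x Sa x = 1 by rewrite -eq_tot.
    have mu0 : mu (~` unmet) = 0 by rewrite probability_setC// mu1 subee.
    rewrite -a1 !(ge0_negligible_integral (measurableC munmet) measurableT)//.
    + by apply: eq_integral => x /[!inE] -[_ /contrapT /sup].
    + by move=> x _; rewrite lee_fin.
have [Sa1 Sb1] := one.
exists m; split=> // A mA.
- by rewrite int_Sa//; apply: eq_integral_of_total.
- by rewrite int_Sb//; apply: eq_integral_of_total.
Qed.

Theorem theorem19 (R : realType) (G : groupType)
    (G_countable : countable [set: G]) (G_infinite : infinite_set [set: G])
    (mu : probability (config G) R)
    (mu_invariant : invariant_measure mu) (mu_ergodic : ergodic_measure mu)
    (mu_head : 0 < mu head_at_id < 1) :
  exists (d : measure_display) (Omega : measurableType d)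
    (P : probability Omega R)
    (Gamma : {RV P >-> config G}) (X : {RV P >-> discrete_group G}),
    extra_head_scheme mu Gamma X.
Proof.
have [e e_surj] := countable_enum G_countable.
have mH : measurable (@head_at_id G) by exact: measurable_head.
pose p : R := fine (mu head_at_id).
have pE : mu head_at_id = p%:E by rewrite fineK// fin_num_measure.
have p_gt0 : (0 < p)%R by move: mu_head; rewrite pE lte_fin => /andP[].
pose b0 (gamma : config G) : R := (p^-1 * \1_head_at_id gamma)%R.
have int_b0 A : measurable A ->
    (\int[mu]_(x in A) (b0 x)%:E)%E = conditional_law mu A.
  move=> mA; under eq_integral do rewrite EFinM.
  rewrite ge0_integralZl//; last 2 first.
  - by apply/measurable_EFinP; exact: measurable_indic.
  - by rewrite lee_fin invr_ge0 ltW.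
  rewrite integral_indic// /conditional_law pE muleC setIC.
  by rewrite inver gt_eqF.
have int_1 A : measurable A -> (\int[mu]_(x in A) (cst 1%R x)%:E)%E = mu A.
  by move=> mA; rewrite -[RHS]mul1e -integral_cst.
have [||||||m [mm m0 law_a law_b]] :=
    @balanced_transport R G mu e (cst 1%R) b0 mu_invariant mu_ergodic e_surj.
- by move=> x.
- by move=> x; rewrite mulr_ge0// ?invr_ge0 ltW.
- exact: measurable_cst.
- by apply: measurable_funM => //; exact: measurable_indic.
- by rewrite int_1// probability_setT.
- rewrite int_b0// /conditional_law setTI pE.
  by rewrite inver gt_eqF// -EFinM divff// gt_eqF.
pose phi k (gamma : config G) : config G * discrete_group G :=
  (gamma, e k : discrete_group G).
have mphi k : measurable_fun setT (phi k).
  by apply: measurable_fun_pair => //; exact: measurable_cst.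
have [|P PE] := @mixture_probability R _ _ mu _
  (config G * discrete_group G)%type phi m mphi mm m0.
  by rewrite law_a// int_1// probability_setT.
pose mG := isMeasurableFun.Build _ _ _ _ _ (@measurable_fst _ _ (config G) (discrete_group G)).
pose Gamma : {RV P >-> config G} := HB.pack (@fst (config G) (discrete_group G)) mG.
pose mX := isMeasurableFun.Build _ _ _ _ _ (@measurable_snd _ _ (config G) (discrete_group G)).
pose X : {RV P >-> discrete_group G} := HB.pack (@snd (config G) (discrete_group G)) mX.
exists _, (config G * discrete_group G)%type, P, Gamma, X.
split; split.
- exact: measurable_fst.
- move=> A mA; rewrite /pushforward PE.
  transitivity (\sum_(k <oo) \int[mu]_(x in A) m k x) => //.
  by rewrite law_a// int_1.
- exact: measurable_recentre.
- move=> A mA; rewrite /pushforward PE -int_b0//.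
  by rewrite -law_b.
Qed.
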